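(* Let $H$ be a bialgebra over a field $K$, let $A$ be an $H$-module-algebra with action map $\lambda$, and let $\Lambda_t=\sum_{i=0}^N\lambda_it^i$ be a deformation of $A$ of order $N\ge1$. Let $\mathrm{Ob}=\sum_{i=1}^N\lambda_i\cup\lambda_{N+1-i}\in\mathcal{F}^2(A)$, which is a $2$-cocycle. Then $\Lambda_t$ extends to order $N+1$ if and only if the $2$-cocycle $-\mathrm{Ob}$ is a $2$-coboundary, i.e. $-\mathrm{Ob}=d^1\psi$ for some $\psi\in\mathcal{F}^1(A)$.
   Context: Fix a field $K$; $\otimes$ and $\mathrm{Hom}$ are over $K$. $(H,\mu_H,\Delta_H)$ is a $K$-bialgebra; Sweedler notation $\Delta_H(x)=\sum_{(x)} x_{(1)}\otimes x_{(2)}$. $\mathrm{End}(A)$ is the algebra of $K$-linear endomorphisms of $A$. An associative $K$-algebra $A$ is an $H$-module-algebra if it has an $H$-module structure $\lambda\in\mathrm{Hom}(H,\mathrm{End}(A))$ with $\lambda(xy)=\lambda(x)\circ\lambda(y)$ and $\lambda(x)(ab)=\sum_{(x)}\lambda(x_{(1)})(a)\cdot\lambda(x_{(2)})(b)$ for $x,y\in H$, $a,b\in A$. Cochains: $\mathcal{F}^1(A)=\mathrm{Hom}(H,\mathrm{End}(A))$, and for $n\ge2$, $\mathcal{F}^n(A)=\mathrm{Hom}(H^{\otimes n},\mathrm{End}(A))\oplus\mathrm{Hom}(H,\mathrm{Hom}(A^{\otimes n},A))$, with elements written $(\varphi_0;\varphi_1)$; the differential is $d^n(\varphi_0;\varphi_1)=(d^n_0\varphi_0;d^n_1\varphi_1)$,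 where $$(d^n_0\varphi_0)(x_1\otimes\cdots\otimes x_{n+1})=\lambda(x_1)\circ\varphi_0(x_2\otimes\cdots\otimes x_{n+1})+\sum_{i=1}^n(-1)^i\varphi_0(x_1\otimes\cdots\otimes x_ix_{i+1}\otimes\cdots\otimes x_{n+1})+(-1)^{n+1}\varphi_0(x_1\otimes\cdots\otimes x_n)\circ\lambda(x_{n+1}),$$ $$(d^n_1\varphi_1)(x)(a_1\otimes\cdots\otimes a_{n+1})=\sum_{(x)}\lambda(x_{(1)})(a_1)\cdot\varphi_1(x_{(2)})(a_2\otimes\cdots\otimes a_{n+1})+\sum_{i=1}^n(-1)^i\varphi_1(x)(a_1\otimes\cdots\otimes a_ia_{i+1}\otimes\cdots\otimes a_{n+1})+(-1)^{n+1}\sum_{(x)}\varphi_1(x_{(1)})(a_1\otimes\cdots\otimes a_n)\cdot\lambda(x_{(2)})(a_{n+1}).$$ For $n=1$, $\varphi_0=\varphi_1=\varphi$, so $d^1\varphi=(d^1_0\varphi;d^1_1\varphi)$. Cup-product of $f,g\in\mathcal{F}^1(A)$: $f\cup g=((f\cup g)_0;(f\cup g)_1)\in\mathcal{F}^2(A)$ with $(f\cup g)_0(x\otimes y)=f(x)\circ g(y)$ and $(f\cup g)_1(x)(a\otimes b)=\sum_{(x)}f(x_{(1)})(a)\cdot g(x_{(2)})(b)$. A deformation of order $N$ of $A$ is a polynomial $\Lambda_t=\sum_{i=0}^N\lambda_it^i$ with $\lambda_0=\lambda$, each $\lambda_i\in\mathcal{F}^1(A)$, such that for all $0\le n\le N$,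 $x,y\in H$, $a,b\in A$: $\lambda_n(xy)=\sum_{i+j=n}\lambda_i(x)\circ\lambda_j(y)$ and $\lambda_n(x)(ab)=\sum_{(x)}\sum_{i+j=n}\lambda_i(x_{(1)})(a)\cdot\lambda_j(x_{(2)})(b)$. It extends to order $N+1$ if there is $\lambda_{N+1}\in\mathcal{F}^1(A)$ such that $\Lambda_t+\lambda_{N+1}t^{N+1}$ is a deformation of order $N+1$. *)

(* Defs.v *)
From HB Require Import structures.
From mathcomp Require Import all_boot all_order all_algebra.
From mathcomp Require Import boolp.

Set Implicit Arguments.
Unset Strict Implicit.
Unset Printing Implicit Defensive.

Import GRing.Theory.
Local Open Scope quotient_scope.
Local Open Scope ring_scope.

(* Hom(U, V) is the type {linear U -> V}; it is made into a K-vector space.   *)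
Section Hom.
Context (K : fieldType) (U V : lmodType K).
Implicit Types f g h : {linear U -> V}.

Definition mklin (f : U -> V) (hf : linear f) : {linear U -> V} :=
  HB.pack f (GRing.isLinear.Build K U V *:%R f hf).

Lemma hom_ext f g : (forall u, f u = g u) -> f = g.
Proof.
move=> fg; have /funext : f =1 g by [].
case: f g {fg} => f [[mf] [nf]] [g [[mg] [ng]]] /= fg; subst g.
by rewrite (Prop_irrelevance mf mg) (Prop_irrelevance nf ng).
Qed.

Lemma islinD (f g : U -> V) :
  linear f -> linear g -> linear (fun u => f u + g u).
Proof. by move=> lf lg c u v; rewrite lf lg scalerDr addrACA. Qed.

Lemma islinN (f : U -> V) : linear f -> linear (fun u => - f u).
Proof. by move=> lf c u v; rewrite lf opprD scalerN. Qed.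

Lemma islinB (f g : U -> V) :
  linear f -> linear g -> linear (fun u => f u - g u).
Proof. by move=> lf lg; apply: islinD => //; apply: islinN. Qed.

Lemma islin0 : linear (fun _ : U => 0 : V).
Proof. by move=> c u v; rewrite scaler0 addr0. Qed.

Lemma islinZ (c : K) (f : U -> V) :
  linear f -> linear (fun u => c *: f u).
Proof. by move=> lf d u v; rewrite lf scalerDr !scalerA mulrC. Qed.

Lemma islin_sum (I : Type) (r : seq I) (F : I -> U -> V) :
  (forall i, linear (F i)) -> linear (fun u => \sum_(i <- r) F i u).
Proof.
move=> lF c u v; rewrite scaler_sumr -big_split /=.
by apply: eq_bigr => i _; rewrite lF.
Qed.

Definition hom0 : {linear U -> V} := mklin islin0.
Definition homD f g : {linear U -> V} := mklin (islinD (linearP f) (linearP g)).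
Definition homN f : {linear U -> V} := mklin (islinN (linearP f)).
Definition homZ (c : K) f : {linear U -> V} := mklin (islinZ c (linearP f)).

Fact homDA : associative homD.
Proof. by move=> f g h; apply: hom_ext => u /=; rewrite addrA. Qed.
Fact homDC : commutative homD.
Proof. by move=> f g; apply: hom_ext => u /=; rewrite addrC. Qed.
Fact hom0D : left_id hom0 homD.
Proof. by move=> f; apply: hom_ext => u /=; rewrite add0r. Qed.
Fact homND : left_inverse hom0 homN homD.
Proof. by move=> f; apply: hom_ext => u /=; rewrite addNr. Qed.

HB.instance Definition _ := gen_eqMixin {linear U -> V}.
HB.instance Definition _ := gen_choiceMixin {linear U -> V}.
HB.instance Definition _ :=
  GRing.isZmodule.Build {linear U -> V} homDA homDC hom0D homND.

Fact homZA c d f : homZ c (homZ d f) = homZ (c * d) f.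
Proof. by apply: hom_ext => u /=; rewrite scalerA. Qed.
Fact hom1Z : left_id 1 homZ.
Proof. by move=> f; apply: hom_ext => u /=; rewrite scale1r. Qed.
Fact homZDr : right_distributive homZ +%R.
Proof. by move=> c f g; apply: hom_ext => u /=; rewrite scalerDr. Qed.
Fact homZDl f : {morph homZ^~ f : c d / c + d}.
Proof. by move=> c d; apply: hom_ext => u /=; rewrite scalerDl. Qed.

HB.instance Definition _ :=
  GRing.Zmodule_isLmodule.Build K {linear U -> V} homZA hom1Z homZDr homZDl.

Lemma homDE f g u : (f + g) u = f u + g u. Proof. by []. Qed.
Lemma homNE f u : (- f) u = - f u. Proof. by []. Qed.
Lemma homZE c f u : (c *: f) u = c *: f u. Proof. by []. Qed.
Lemma hom0E u : (0 : {linear U -> V}) u = 0. Proof. by []. Qed.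

End Hom.

Notation bilin F := (bilinear_for *:%R *:%R F).

Section Closure.
Context (K : fieldType).
Implicit Types U V W : lmodType K.

Lemma islin_comp U V W (f : {linear V -> W}) (g : U -> V) :
  linear g -> linear (fun u => f (g u)).
Proof. by move=> lg c u v; rewrite lg linearP. Qed.

Lemma islin_ev U V W (F : U -> {linear V -> W}) v :
  linear F -> linear (fun u => F u v).
Proof. by move=> lF c u u'; rewrite lF. Qed.

End Closure.

Definition hcomp (K : fieldType) (U V W : lmodType K)
    (f : {linear V -> W}) (g : {linear U -> V}) : {linear U -> W} :=
  mklin (islin_comp f (linearP g)).

Notation "f ∘ g" := (hcomp f g) (at level 40, left associativity) : ring_scope.

Section HcompClosure.
Context (K : fieldType).
Implicit Types U V W X : lmodType K.

Lemma islin_hcompl U V W X (F : X -> {linear V -> W}) (g : {linear U -> V}) :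
  linear F -> linear (fun x => F x ∘ g).
Proof. by move=> lF c x y; apply: hom_ext => u /=; rewrite lF. Qed.

Lemma islin_hcompr U V W X (f : {linear V -> W}) (G : X -> {linear U -> V}) :
  linear G -> linear (fun x => f ∘ G x).
Proof. by move=> lG c x y; apply: hom_ext => u /=; rewrite lG linearP. Qed.

End HcompClosure.

(* U ⊗ V: finite formal sums of pairs (u, v), modulo the congruence generated *)
(* by bilinearity. Formal sums need no coefficients, as c (u, v) = (c u, v).  *)
Section Tensor.
Context (K : fieldType) (U V : lmodType K).
Implicit Types (s t : seq (U * V)) (u : U) (v : V) (c : K).

Inductive tens_rel : seq (U * V) -> seq (U * V) -> Prop :=
| tens_refl s : tens_rel s s
| tens_sym s t : tens_rel s t -> tens_rel t s
| tens_trans s t r : tens_rel s t -> tens_rel t r -> tens_rel s r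
| tens_cat s s' t t' :
    tens_rel s s' -> tens_rel t t' -> tens_rel (s ++ t) (s' ++ t')
| tens_catC s t : tens_rel (s ++ t) (t ++ s)
| tens_0l v : tens_rel [:: (0, v)] [::]
| tens_Dl u u' v : tens_rel [:: (u + u', v)] [:: (u, v); (u', v)]
| tens_Dr u v v' : tens_rel [:: (u, v + v')] [:: (u, v); (u, v')]
| tens_Z c u v : tens_rel [:: (c *: u, v)] [:: (u, c *: v)].

Definition tens_eqb s t : bool := `[< tens_rel s t >].

Fact tens_eqb_equiv : equiv_class_of tens_eqb.
Proof.
split=> [s | s t | s t r].
- by apply/asboolP; apply: tens_refl.
- by apply/asboolP/asboolP; apply: tens_sym.
- by move=> /asboolP h1 /asboolP h2; apply/asboolP; apply: tens_trans h1 h2.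
Qed.
Canonical tens_equiv := EquivRelPack tens_eqb_equiv.

Definition tens := {eq_quot tens_equiv}.
HB.instance Definition _ := Choice.on tens.
HB.instance Definition _ := EqQuotient.on tens.

Definition cls s : tens := \pi_tens s.

Lemma clsP s t : cls s = cls t <-> tens_rel s t.
Proof.
rewrite /cls; split=> [/eqP | h].
  by rewrite eqmodE => /asboolP.
by apply/eqP; rewrite eqmodE; apply/asboolP.
Qed.

Lemma repr_cls s : tens_rel (repr (cls s)) s.
Proof. by apply/clsP; rewrite /cls reprK. Qed.

Lemma cls_repr (x : tens) : cls (repr x) = x.
Proof. by rewrite /cls reprK. Qed.

Definition fscale c s : seq (U * V) := [seq (c *: p.1, p.2) | p <- s].

Lemma fscale_rel c s t : tens_rel s t -> tens_rel (fscale c s) (fscale c t).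
Proof.
elim=> {s t} [s|s t _ h|s t r _ h _ h'|s s' t t' _ h _ h'|s t|v|u u' v|u v v'|d u v].
- exact: tens_refl.
- exact: tens_sym.
- exact: tens_trans h h'.
- by rewrite /fscale !map_cat; apply: tens_cat.
- by rewrite /fscale !map_cat; apply: tens_catC.
- by rewrite /= scaler0; apply: tens_0l.
- by rewrite /= scalerDr; apply: tens_Dl.
- exact: tens_Dr.
- by rewrite /= scalerA mulrC -scalerA; apply: tens_Z.
Qed.

Definition tens0 : tens := cls [::].
Definition tensD (x y : tens) : tens := cls (repr x ++ repr y).
Definition tensZ c (x : tens) : tens := cls (fscale c (repr x)).
Definition tensN (x : tens) : tens := tensZ (-1) x.

Lemma tensD_cls s t : tensD (cls s) (cls t) = cls (s ++ t).
Proof. by apply/clsP; apply: tens_cat; apply: repr_cls. Qed.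

Lemma tensZ_cls c s : tensZ c (cls s) = cls (fscale c s).
Proof. by apply/clsP; apply: fscale_rel; apply: repr_cls. Qed.

Lemma cls_ind (P : tens -> Prop) : (forall s, P (cls s)) -> forall x, P x.
Proof. by move=> h x; rewrite -(cls_repr x). Qed.

Fact tensDA : associative tensD.
Proof.
elim/cls_ind=> s; elim/cls_ind=> t; elim/cls_ind=> r.
by rewrite !tensD_cls catA.
Qed.
Fact tensDC : commutative tensD.
Proof.
elim/cls_ind=> s; elim/cls_ind=> t; rewrite !tensD_cls.
by apply/clsP; apply: tens_catC.
Qed.
Fact tens0D : left_id tens0 tensD.
Proof. by elim/cls_ind=> s; rewrite tensD_cls. Qed.

Lemma fscaleD c d s : tens_rel (fscale (c + d) s) (fscale c s ++ fscale d s).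
Proof.
elim: s => [|[u v] s ih] /=; first exact: tens_refl.
rewrite -[_ :: fscale (c + d) s]cat1s scalerDl.
apply: tens_trans (tens_cat (tens_Dl _ _ _) ih) _; rewrite /=.
apply: (tens_cat (tens_refl [:: (c *: u, v)])).
rewrite -[(d *: u, v) :: fscale c s ++ _]/([:: (d *: u, v)] ++ fscale c s ++ fscale d s).
rewrite catA -[_ :: fscale d s]cat1s [_ ++ [:: _] ++ _]catA.
exact: tens_cat (tens_catC _ _) (tens_refl _).
Qed.

Lemma fscale0 s : tens_rel (fscale 0 s) [::].
Proof.
elim: s => [|[u v] s ih] /=; first exact: tens_refl.
by rewrite scale0r; apply: (tens_cat (tens_0l v) ih).
Qed.

Lemma fscale1 s : fscale 1 s = s.
Proof. by elim: s => [|[u v] s ih] //=; rewrite scale1r ih. Qed.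

Fact tensND : left_inverse tens0 tensN tensD.
Proof.
elim/cls_ind=> s; rewrite /tensN tensZ_cls tensD_cls.
apply/clsP; rewrite -{2}[s]fscale1.
apply: tens_trans (tens_sym (fscaleD _ _ _)) _.
by rewrite addNr; apply: fscale0.
Qed.

HB.instance Definition _ := GRing.isZmodule.Build tens tensDA tensDC tens0D tensND.

Fact tensZA c d (x : tens) : tensZ c (tensZ d x) = tensZ (c * d) x.
Proof.
elim/cls_ind: x => s; rewrite !tensZ_cls /fscale -map_comp.
by congr cls; apply: eq_map => -[u v] /=; rewrite scalerA.
Qed.
Fact tens1Z : left_id 1 tensZ.
Proof. by elim/cls_ind=> s; rewrite tensZ_cls fscale1. Qed.
Fact tensZDr : right_distributive tensZ +%R.
Proof.
move=> c; elim/cls_ind=> s; elim/cls_ind=> t.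
change (tensZ c (tensD (cls s) (cls t)) = tensD (tensZ c (cls s)) (tensZ c (cls t))).
by rewrite tensD_cls !tensZ_cls tensD_cls /fscale map_cat.
Qed.
Fact tensZDl (x : tens) : {morph tensZ^~ x : c d / c + d}.
Proof.
move=> c d; elim/cls_ind: x => s.
by rewrite !tensZ_cls [RHS]tensD_cls; apply/clsP; apply: fscaleD.
Qed.

HB.instance Definition _ :=
  GRing.Zmodule_isLmodule.Build K tens tensZA tens1Z tensZDr tensZDl.

Definition pure u v : tens := cls [:: (u, v)].

Lemma cls_cat s t : cls (s ++ t) = cls s + cls t.
Proof. by rewrite [RHS]tensD_cls. Qed.

Lemma cls_sum s : cls s = \sum_(p <- s) pure p.1 p.2.
Proof.
elim: s => [|[u v] s ih]; first by rewrite big_nil.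
by rewrite big_cons -ih -cat1s cls_cat.
Qed.

Lemma pure_bilin : bilin pure.
Proof.
split=> [v c u u' | u c v v'] /=.
  have -> : c *: pure u v = pure (c *: u) v by rewrite [LHS]tensZ_cls.
  by rewrite -cls_cat; apply/clsP; apply: tens_Dl.
have -> : c *: pure u v = pure u (c *: v).
  by rewrite [LHS]tensZ_cls; apply/clsP; apply: tens_Z.
by rewrite -cls_cat; apply/clsP; apply: tens_Dr.
Qed.

(* tsum F x is the sum of the F(u_i, v_i) over a chosen decomposition of the  *)
(* tensor x as a sum of u_i ⊗ v_i. For a bilinear F the result is independent *)
(* of the decomposition, see tsum_cls: this is the meaning of Sweedler sums.  *)
Definition tsum (W : lmodType K) (F : U -> V -> W) (x : tens) : W :=
  \sum_(p <- repr x) F p.1 p.2.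

Section Lift.
Context (W : lmodType K) (F : U -> V -> W) (hF : bilin F).

Lemma bilin_rel s t : tens_rel s t ->
  \sum_(p <- s) F p.1 p.2 = \sum_(p <- t) F p.1 p.2.
Proof.
have [hl hr] := hF.
have hl0 v : F 0 v = 0.
  have := hl v (-1) 0 0; rewrite /= scaler0 addr0 => {1}->.
  by rewrite scaleN1r addNr.
have hr0 u : F u 0 = 0.
  have := hr u (-1) 0 0; rewrite /= scaler0 addr0 => {1}->.
  by rewrite scaleN1r addNr.
elim=> {s t} [s|s t _ h|s t r _ h _ h'|s s' t t' _ h _ h'|s t|v|u u' v|u v v'|d u v] //=.
- by rewrite h h'.
- by rewrite !big_cat /= h h'.
- by rewrite !big_cat /= addrC.
- by rewrite big_nil big_seq1 hl0.
- rewrite !big_cons !big_nil !addr0 /=.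
  by have := hl v 1 u u'; rewrite /= !scale1r => ->.
- rewrite !big_cons !big_nil !addr0 /=.
  by have := hr u 1 v v'; rewrite /= !scale1r => ->.
- rewrite !big_seq1 /=.
  have := hl v d u 0; have := hr u d v 0.
  by rewrite /= !addr0 hl0 hr0 !addr0 => -> ->.
Qed.

Lemma tsum_cls s : tsum F (cls s) = \sum_(p <- s) F p.1 p.2.
Proof. by apply: bilin_rel; apply: repr_cls. Qed.

Lemma tsum_pure u v : tsum F (pure u v) = F u v.
Proof. by rewrite tsum_cls big_seq1. Qed.

Lemma tsum_linear : linear (tsum F).
Proof.
move=> c; elim/cls_ind=> s; elim/cls_ind=> t.
have -> : c *: cls s + cls t = cls (fscale c s ++ t).
  by rewrite cls_cat; congr (_ + _); rewrite [LHS]tensZ_cls.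
rewrite !tsum_cls big_cat /= scaler_sumr /fscale big_map; congr (_ + _).
apply: eq_bigr => -[u v] _ /=; have [hl _] := hF.
have h0 : F 0 v = 0.
  have := hl v (-1) 0 0; rewrite /= scaler0 addr0 => {1}->.
  by rewrite scaleN1r addNr.
by have := hl v c u 0; rewrite /= !addr0 h0 addr0.
Qed.

Definition tlift : {linear tens -> W} := mklin tsum_linear.

Lemma tlift_pure u v : tlift (pure u v) = F u v.
Proof. exact: tsum_pure. Qed.

End Lift.

Lemma tens_ext (W : lmodType K) (f g : {linear tens -> W}) :
  (forall u v, f (pure u v) = g (pure u v)) -> f = g.
Proof.
move=> h; apply: hom_ext; elim/cls_ind=> s.
by rewrite cls_sum !linear_sum; apply: eq_bigr => p _; apply: h.
Qed.

End Tensor.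

Notation "U ⊗ V" := (tens U V) (at level 40, left associativity) : type_scope.
Notation "u ⊗ v" := (pure u v) (at level 40, left associativity) : ring_scope.
Notation "\tsum_ ( a , b <- x ) F" := (tsum (fun a b => F) x)
  (at level 41, a name, b name, x at level 200, F at level 41,
   format "\tsum_ ( a ,  b  <-  x )  F") : ring_scope.

HB.mixin Record Algebra_isBialgebra (K : fieldType) H of GRing.Algebra K H := {
  Delta : {linear H -> (H ⊗ H)%type};
  counit : {scalar H};
  Delta_coassoc : forall x : H,
    \tsum_(x1, x2 <- Delta x) \tsum_(y1, y2 <- Delta x1) (y1 ⊗ (y2 ⊗ x2))
    = \tsum_(x1, x2 <- Delta x) (x1 ⊗ Delta x2) :> (H ⊗ (H ⊗ H))%type;
  counitl : forall x : H, \tsum_(x1, x2 <- Delta x) (counit x1 *: x2) = x;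
  counitr : forall x : H, \tsum_(x1, x2 <- Delta x) (counit x2 *: x1) = x;
  DeltaM : forall x y : H,
    Delta (x * y) =
    \tsum_(x1, x2 <- Delta x) \tsum_(y1, y2 <- Delta y)
      ((x1 * y1) ⊗ (x2 * y2));
  Delta1 : Delta 1 = 1 ⊗ 1;
  counitM : forall x y : H, counit (x * y) = counit x * counit y;
  counit1 : counit 1 = 1
}.

#[short(type="bialgType")]
HB.structure Definition Bialgebra (K : fieldType) :=
  {H of GRing.Algebra K H & Algebra_isBialgebra K H}.

(* Unlike an algType, the algebra is not assumed unital.                      *)
HB.mixin Record Lmodule_isAssocAlg (K : fieldType) A of GRing.Lmodule K A := {
  amul : A -> A -> A;
  amulA : associative amul;
  amul_bilin : bilin amul
}.

#[short(type="assocAlgType")]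
HB.structure Definition AssocAlg (K : fieldType) :=
  {A of GRing.Lmodule K A & Lmodule_isAssocAlg K A}.

Notation "a ∙ b" := (amul a b) (at level 40, left associativity) : ring_scope.

Notation Endo A := {linear A -> A}.
Notation F1 H A := {linear H -> Endo A}.
Notation F2 H A :=
  ({linear (H ⊗ H)%type -> Endo A} * {linear H -> {linear (A ⊗ A)%type -> A}})%type.
Notation F3 H A :=
  ({linear (H ⊗ (H ⊗ H))%type -> Endo A}
   * {linear H -> {linear (A ⊗ (A ⊗ A))%type -> A}})%type.

Section Trilinear.
Context (K : fieldType) (U V W Z : lmodType K).

Definition trilin (F : U -> V -> W -> Z) : Prop :=
  [/\ forall v w, linear (fun u => F u v w),
      forall u w, linear (fun v => F u v w) &
      forall u v, linear (fun w => F u v w)].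

Lemma trilin_inner F : trilin F -> forall u, bilin (F u).
Proof. by case=> _ h2 h3 u; split=> [w | v]; [apply: h2 | apply: h3]. Qed.

Lemma trilin_outer F (hF : trilin F) :
  bilin (fun u (t : V ⊗ W) => tlift (trilin_inner hF u) t).
Proof.
have [h1 _ _] := hF; split=> [t | u]; last exact: linearP.
move=> c u u'; pose ev (f : {linear (V ⊗ W)%type -> Z}) := f t.
apply: (congr1 ev (x := tlift (trilin_inner hF (c *: u + u')))
  (y := c *: tlift (trilin_inner hF u) + tlift (trilin_inner hF u'))).
by apply: tens_ext => v w; rewrite homDE homZE !tlift_pure h1.
Qed.

Definition tlift3 F (hF : trilin F) : {linear (U ⊗ (V ⊗ W))%type -> Z} :=
  tlift (trilin_outer hF).

Lemma tlift3_pure F (hF : trilin F) u v w : tlift3 hF (u ⊗ (v ⊗ w)) = F u v w.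
Proof. by rewrite /tlift3 !tlift_pure. Qed.

Lemma tens_ext3 (f g : {linear (U ⊗ (V ⊗ W))%type -> Z}) :
  (forall u v w, f (u ⊗ (v ⊗ w)) = g (u ⊗ (v ⊗ w))) -> f = g.
Proof.
move=> h; apply: tens_ext => u t.
have lp : linear (fun t : (V ⊗ W)%type => u ⊗ t) by apply: (pure_bilin _ _).2.
have E : f ∘ mklin lp = g ∘ mklin lp by apply: tens_ext => v w; apply: h.
exact: (congr1 (fun k : {linear (V ⊗ W)%type -> Z} => k t) E).
Qed.

End Trilinear.

Section ClosureAlg.
Context (K : fieldType) (A : assocAlgType K).
Implicit Types U V W X : lmodType K.

Lemma islin_amull U (f : U -> A) (b : A) :
  linear f -> linear (fun u => f u ∙ b).
Proof. by move=> lf c u v; rewrite lf; apply: (amul_bilin (s := A)).1. Qed.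

Lemma islin_amulr U (a : A) (f : U -> A) :
  linear f -> linear (fun u => a ∙ f u).
Proof. by move=> lf c u v; rewrite lf; apply: (amul_bilin (s := A)).2. Qed.

Lemma islin_purel U V W (f : U -> V) (w : W) :
  linear f -> linear (fun u => f u ⊗ w).
Proof. by move=> lf c u v; rewrite lf; apply: (pure_bilin V W).1. Qed.

Lemma islin_purer U V W (v : V) (f : U -> W) :
  linear f -> linear (fun u => v ⊗ f u).
Proof. by move=> lf c u u'; rewrite lf; apply: (pure_bilin V W).2. Qed.

Lemma islin_id U : linear (fun u : U => u).
Proof. by []. Qed.

Lemma islin_tsum_arg U V W X (F : U -> V -> W) (g : X -> (U ⊗ V)%type) :
  bilin F -> linear g -> linear (fun x : X => tsum F (g x)).
Proof. by move=> hF lg c x y; rewrite lg; apply: tsum_linear. Qed.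

Lemma islin_tsum_body U V W X (F : X -> U -> V -> W) (t : (U ⊗ V)%type) :
  (forall u v, linear (fun x => F x u v)) ->
  linear (fun x : X => tsum (F x) t).
Proof. by move=> hF; apply: islin_sum => p; apply: hF. Qed.

End ClosureAlg.

Section Complex.
Context (K : fieldType) (H : bialgType K) (A : assocAlgType K).

Section CupProduct.
Variables f g : F1 H A.

Fact cup_0_bilin : bilin (fun x y : H => f x ∘ g y).
Proof.
split=> [y | x].
  by apply: islin_hcompl; apply: linearP.
by apply: islin_hcompr; apply: linearP.
Qed.

Definition cup_0 : {linear (H ⊗ H)%type -> Endo A} := tlift cup_0_bilin.

Fact cup_sw_bilin (a b : A) : bilin (fun x1 x2 : H => f x1 a ∙ g x2 b).
Proof.
split=> [x2 | x1].
  by apply: islin_amull; apply: islin_ev; apply: linearP.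
by apply: islin_amulr; apply: islin_ev; apply: linearP.
Qed.

Fact cup_1_bilin (x : H) :
  bilin (fun a b : A => \tsum_(x1, x2 <- Delta x) (f x1 a ∙ g x2 b)).
Proof.
split=> [b | a]; apply: islin_tsum_body => x1 x2.
  by apply: islin_amull; apply: linearP.
by apply: islin_amulr; apply: linearP.
Qed.

Fact cup_1_linear : linear (fun x : H => tlift (cup_1_bilin x)).
Proof.
move=> c x y; apply: tens_ext => a b; rewrite homDE homZE !tlift_pure.
by rewrite linearP (tsum_linear (cup_sw_bilin a b)).
Qed.

Definition cup_1 : {linear H -> {linear (A ⊗ A)%type -> A}} := mklin cup_1_linear.

Definition cup : F2 H A := (cup_0, cup_1).

End CupProduct.

Variable lam : F1 H A.

(* No condition on lam 1: the module need not be unital.                      *)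
Definition is_module_algebra : Prop :=
  (forall x y : H, lam (x * y) = lam x ∘ lam y) /\
  (forall (x : H) (a b : A),
     lam x (a ∙ b) = \tsum_(x1, x2 <- Delta x) (lam x1 a ∙ lam x2 b)).

Section D1.
Variable phi : F1 H A.

Fact d1_0_bilin :
  bilin (fun x y : H => lam x ∘ phi y - phi (x * y) + phi x ∘ lam y).
Proof.
split=> [y | x]; apply: islinD; first apply: islinB.
- by apply: islin_hcompl; apply: linearP.
- by apply: islin_comp => c u v /=; rewrite mulrDl scalerAl.
- by apply: islin_hcompl; apply: linearP.
- apply: islinB; first by apply: islin_hcompr; apply: linearP.
  by apply: islin_comp => c u v /=; rewrite mulrDr scalerAr.
- by apply: islin_hcompr; apply: linearP.
Qed.

Definition d1_0 : {linear (H ⊗ H)%type -> Endo A} := tlift d1_0_bilin.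

Fact d1_1_bilin (x : H) :
  bilin (fun a b : A =>
    \tsum_(x1, x2 <- Delta x) (lam x1 a ∙ phi x2 b)
    - phi x (a ∙ b)
    + \tsum_(x1, x2 <- Delta x) (phi x1 a ∙ lam x2 b)).
Proof.
have [cl cr] := cup_1_bilin lam phi x; have [cl' cr'] := cup_1_bilin phi lam x.
split=> [b | a]; apply: islinD => //; apply: islinB => //; apply: islin_comp.
  by apply: islin_amull.
by apply: islin_amulr.
Qed.

Fact d1_1_linear : linear (fun x : H => tlift (d1_1_bilin x)).
Proof.
move=> c x y; apply: tens_ext => a b; rewrite homDE homZE !tlift_pure.
move: c x y; apply: islinD; first apply: islinB.
- by apply: islin_tsum_arg (linearP _); apply: cup_sw_bilin.
- by apply: islin_ev; apply: linearP.
- by apply: islin_tsum_arg (linearP _); apply: cup_sw_bilin.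
Qed.

Definition d1_1 : {linear H -> {linear (A ⊗ A)%type -> A}} := mklin d1_1_linear.

Definition d1 : F2 H A := (d1_0, d1_1).

End D1.

Section D2.
Variable phi : F2 H A.

Fact d2_0_trilin :
  trilin (fun x y z : H =>
    lam x ∘ phi.1 (y ⊗ z) - phi.1 ((x * y) ⊗ z) + phi.1 (x ⊗ (y * z))
    - phi.1 (x ⊗ y) ∘ lam z).
Proof.
have mulL (y : H) : linear (fun x => x * y).
  by move=> c u v; rewrite mulrDl scalerAl.
have mulR (x : H) : linear (fun y => x * y).
  by move=> c u v; rewrite mulrDr scalerAr.
split=> [y z | x z | x y]; apply: islinB; first [apply: islinD | idtac];
  try apply: islinB.
- by apply: islin_hcompl; apply: linearP.
- by apply: islin_comp; apply: islin_purel.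
- by apply: islin_comp; apply: islin_purel.
- by apply: islin_hcompl; apply: islin_comp; apply: islin_purel.
- by apply: islin_hcompr; apply: islin_comp; apply: islin_purel.
- by apply: islin_comp; apply: islin_purel.
- by apply: islin_comp; apply: islin_purer.
- by apply: islin_hcompl; apply: islin_comp; apply: islin_purer.
- by apply: islin_hcompr; apply: islin_comp; apply: islin_purer.
- by apply: islin_comp; apply: islin_purer.
- by apply: islin_comp; apply: islin_purer.
- by apply: islin_hcompr; apply: linearP.
Qed.

Definition d2_0 : {linear (H ⊗ (H ⊗ H))%type -> Endo A} := tlift3 d2_0_trilin.

Fact d2_1_trilin (x : H) :
  trilin (fun a b c : A =>
    \tsum_(x1, x2 <- Delta x) (lam x1 a ∙ phi.2 x2 (b ⊗ c))
    - phi.2 x ((a ∙ b) ⊗ c) + phi.2 x (a ⊗ (b ∙ c))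
    - \tsum_(x1, x2 <- Delta x) (phi.2 x1 (a ⊗ b) ∙ lam x2 c)).
Proof.
split=> [b c | a c | a b]; apply: islinB; first [apply: islinD | idtac];
  try apply: islinB.
- by apply: islin_tsum_body => x1 x2; apply: islin_amull; apply: linearP.
- by apply: islin_comp; apply: islin_purel; apply: islin_amull.
- by apply: islin_comp; apply: islin_purel.
- by apply: islin_tsum_body => x1 x2; apply: islin_amull; apply: islin_comp;
    apply: islin_purel.
- by apply: islin_tsum_body => x1 x2; apply: islin_amulr; apply: islin_comp;
    apply: islin_purel.
- by apply: islin_comp; apply: islin_purel; apply: islin_amulr.
- by apply: islin_comp; apply: islin_purer; apply: islin_amull.
- by apply: islin_tsum_body => x1 x2; apply: islin_amull; apply: islin_comp;
    apply: islin_purer.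
- by apply: islin_tsum_body => x1 x2; apply: islin_amulr; apply: islin_comp;
    apply: islin_purer.
- by apply: islin_comp; apply: islin_purer.
- by apply: islin_comp; apply: islin_purer; apply: islin_amulr.
- by apply: islin_tsum_body => x1 x2; apply: islin_amulr; apply: linearP.
Qed.

Fact d2_1_linear : linear (fun x : H => tlift3 (d2_1_trilin x)).
Proof.
move=> k x y; apply: tens_ext3 => a b c; rewrite homDE homZE !tlift3_pure.
move: k x y; apply: islinB; first apply: islinD; first apply: islinB.
- apply: islin_tsum_arg (linearP _); split=> [x2 | x1].
    by apply: islin_amull; apply: islin_ev; apply: linearP.
  by apply: islin_amulr; apply: islin_ev; apply: linearP.
- by apply: islin_ev; apply: linearP.
- by apply: islin_ev; apply: linearP.
- apply: islin_tsum_arg (linearP _); split=> [x2 | x1].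
    by apply: islin_amull; apply: islin_ev; apply: linearP.
  by apply: islin_amulr; apply: islin_ev; apply: linearP.
Qed.

Definition d2_1 : {linear H -> {linear (A ⊗ (A ⊗ A))%type -> A}} :=
  mklin d2_1_linear.

Definition d2 : F3 H A := (d2_0, d2_1).

End D2.

Definition is_cocycle2 (phi : F2 H A) : Prop := d2 phi = 0.

Definition is_coboundary2 (phi : F2 H A) : Prop :=
  exists psi : F1 H A, phi = d1 psi.

(* The polynomial sum_i L_i t^i of degree at most N, as the tuple L of its    *)
(* coefficients.                                                              *)
Definition is_deformation (N : nat) (L : N.+1.-tuple (F1 H A)) : Prop :=
  L`_0 = lam /\
  forall n : nat, (n <= N)%N ->
    (forall x y : H, L`_n (x * y) = \sum_(i < n.+1) L`_i x ∘ L`_(n - i) y) /\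
    (forall (x : H) (a b : A),
       L`_n x (a ∙ b) =
       \tsum_(x1, x2 <- Delta x) (\sum_(i < n.+1) (L`_i x1 a ∙ L`_(n - i) x2 b))).

Definition extends (N : nat) (L : N.+1.-tuple (F1 H A)) : Prop :=
  exists mu : F1 H A, is_deformation [tuple of rcons L mu].

Definition Ob (N : nat) (L : N.+1.-tuple (F1 H A)) : F2 H A :=
  \sum_(1 <= i < N.+1) cup L`_i L`_(N.+1 - i).

End Complex.

(* Main.v *)
(** Call the defect of a sequence of cochains at degree [n] the degree-[n] part
    of the failure of [Λ_t] to satisfy the two deformation equations. Appending
    [mu] to a deformation of order [N] leaves the defects of degree at most [N]
    equal to zero, while the defect of degree [N + 1] becomes [Ob + d¹ mu]; this
    gives the equivalence. For every sequence of cochains, (co)associativity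
    yields a Bianchi-type identity for the defects. When the defects of degree at
    most [N] vanish, its part of degree [N + 1] says that the defect of degree
    [N + 1] is a cocycle; take [mu = 0]. *)

Require Import Defs.
From HB Require Import structures.
From mathcomp Require Import all_boot all_order all_algebra.

Set Implicit Arguments.
Unset Strict Implicit.
Unset Printing Implicit Defensive.

Import GRing.Theory.
Local Open Scope ring_scope.

(** * Reindexing and cancellation of finite sums *)

(** Both sides run over the triples of indices with sum [n], grouped by the first index on the left
    and by the last on the right. *)
Lemma sum_antidiagA (V : nmodType) (n : nat) (F : nat -> nat -> nat -> V) :
  \sum_(i < n.+1) \sum_(j < (n - i).+1) F i j (n - i - j)%N
  = \sum_(i < n.+1) \sum_(j < i.+1) F j (i - j)%N (n - i)%N.
Proof.
elim: n F => [|n IH] F; first by rewrite !big_ord1.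
rewrite big_ord_recl [LHS]/=.
under [in RHS]eq_bigr => i _ do rewrite big_ord_recl.
rewrite big_split /= subn0; congr (_ + _).
  by apply: eq_bigr => i _; rewrite subn0.
(* The triples with first index zero are matched; the rest is the case [n] for [F] with its first
   argument shifted. *)
rewrite [RHS]big_ord_recl big_ord0 add0r.
exact: (IH (fun i => F i.+1)).
Qed.

Lemma sum_ord_ends (V : nmodType) (n : nat) (F : nat -> V) :
  \sum_(i < n.+2) F i = F 0 + \sum_(1 <= i < n.+1) F i + F n.+1.
Proof. by rewrite big_ord_recr big_ord_recl big_add1 big_mkord. Qed.

(** Common shape of the two Bianchi identities: [p] stands for the terms with three coefficients,
    [q] and [r] for those with two, [s] for the single one. *)
Lemma alt_sum_cancel (V : zmodType) (p q r s : V) :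
  p - q - (r - s) + (q - s) - (p - r) = 0.
Proof.
rewrite !opprB -addrA [p - q + _]addrACA [q - s + _]addrACA -!opprD [s + p]addrC.
by rewrite addrA subrK subrr.
Qed.

(** * Linearity rules for maps, Sweedler sums and products *)

Section HomSum.
Context (K : fieldType) (U V : lmodType K).

Lemma hom_sumE (I : Type) (r : seq I) (F : I -> {linear U -> V}) u :
  (\sum_(i <- r) F i) u = \sum_(i <- r) F i u.
Proof. exact: (big_morph (fun f : {linear U -> V} => f u)). Qed.

End HomSum.

Section Sweedler.
Context (K : fieldType).

(** As [tsum] runs over one chosen decomposition of [t], this lemma and the next three are rules for
    ordinary finite sums. *)
Lemma eq_tsum (U V W : lmodType K) (F G : U -> V -> W) t :
  (forall u v, F u v = G u v) -> tsum F t = tsum G t.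
Proof. by move=> FG; apply: eq_bigr => p _. Qed.

Lemma tsum_sum (U V W : lmodType K) (I : Type) (r : seq I) (F : I -> U -> V -> W) t :
  tsum (fun u v => \sum_(i <- r) F i u v) t = \sum_(i <- r) tsum (F i) t.
Proof. exact: exchange_big. Qed.

Lemma tsumB (U V W : lmodType K) (F G : U -> V -> W) t :
  tsum (fun u v => F u v - G u v) t = tsum F t - tsum G t.
Proof. exact: sumrB. Qed.

Lemma linear_tsum (U V W X : lmodType K) (f : {linear W -> X}) (F : U -> V -> W) t :
  f (tsum F t) = \tsum_(u, v <- t) f (F u v).
Proof. exact: linear_sum. Qed.

(** [Delta_coassoc] is an identity in a triple tensor product; trilinearity carries it to [Z]
    through [tlift3 hF]. *)
Lemma coassoc_trilin (H : bialgType K) (Z : lmodType K) (F : H -> H -> H -> Z)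
    (hF : trilin F) (x : H) :
  \tsum_(x1, x2 <- Delta x) \tsum_(y1, y2 <- Delta x1) F y1 y2 x2
  = \tsum_(x1, x2 <- Delta x) \tsum_(y1, y2 <- Delta x2) F x1 y1 y2.
Proof.
have := congr1 (tlift3 hF) (Delta_coassoc x); rewrite !linear_tsum.
under eq_tsum => x1 x2.
  rewrite linear_tsum.
  under eq_tsum => y1 y2 do rewrite tlift3_pure.
  over.
move=> ->; apply: eq_tsum => x1 x2.
by rewrite /tlift3 tlift_pure.
Qed.

End Sweedler.

Section Amul.
Context (K : fieldType) (A : assocAlgType K).

(** The suffix names the side of the variable: [amull b] multiplies by [b] on the right. *)
Definition amull (b : A) : {linear A -> A} := mklin (islin_amull b (@islin_id K A)).
Definition amulr (a : A) : {linear A -> A} := mklin (islin_amulr a (@islin_id K A)).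

Lemma amul_suml (I : Type) (r : seq I) (F : I -> A) b :
  (\sum_(i <- r) F i) ∙ b = \sum_(i <- r) F i ∙ b.
Proof. exact: (linear_sum (amull b)). Qed.

Lemma amul_sumr (I : Type) (r : seq I) (F : I -> A) a :
  a ∙ (\sum_(i <- r) F i) = \sum_(i <- r) a ∙ F i.
Proof. exact: (linear_sum (amulr a)). Qed.

Lemma amulBl (a a' b : A) : (a - a') ∙ b = a ∙ b - a' ∙ b.
Proof. exact: (linearB (amull b)). Qed.

Lemma amulBr (a b b' : A) : a ∙ (b - b') = a ∙ b - a ∙ b'.
Proof. exact: (linearB (amulr a)). Qed.

Lemma amul0l (b : A) : 0 ∙ b = 0.
Proof. exact: (linear0 (amull b)). Qed.

Lemma amul0r (a : A) : a ∙ 0 = 0.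
Proof. exact: (linear0 (amulr a)). Qed.

Lemma amul_tsuml (U V : lmodType K) (F : U -> V -> A) t b :
  tsum F t ∙ b = \tsum_(u, v <- t) (F u v ∙ b).
Proof. exact: (linear_tsum (amull b)). Qed.

Lemma amul_tsumr (U V : lmodType K) (F : U -> V -> A) t a :
  a ∙ tsum F t = \tsum_(u, v <- t) (a ∙ F u v).
Proof. exact: (linear_tsum (amulr a)). Qed.

End Amul.

(** * Defects of a sequence of cochains and their Bianchi identities *)

Section Defect.
Context (K : fieldType) (H : bialgType K) (A : assocAlgType K).
Variable l : nat -> F1 H A.

Definition defect_0 n (x y : H) (a : A) : A :=
  \sum_(i < n.+1) l i x (l (n - i)%N y a) - l n (x * y) a.

Definition defect_1 n (x : H) (a b : A) : A :=
  \sum_(i < n.+1) \tsum_(x1, x2 <- Delta x) (l i x1 a ∙ l (n - i)%N x2 b)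
  - l n x (a ∙ b).

(** The left side is the formula of [d2_0] applied to the defects, with [lam] replaced by all the
    coefficients [l i]. *)
Lemma defect_0_bianchi n x y z a :
  \sum_(i < n.+1) l i x (defect_0 (n - i) y z a) - defect_0 n (x * y) z a
  + defect_0 n x (y * z) a - \sum_(i < n.+1) defect_0 i x y (l (n - i)%N z a) = 0.
Proof.
rewrite /defect_0.
under eq_bigr => i _ do rewrite linearB linear_sum.
rewrite !sumrB.
(* The triple composites come grouped by first index in one outer sum and by last index in the
   other; [mulrA] aligns the two terms in [l n]. *)
rewrite (sum_antidiagA n (fun i j k => l i x (l j y (l k z a)))) mulrA.
exact: alt_sum_cancel.
Qed.

(** The same cancellation, where the two triple products agree by coassociativity of [H] and
    associativity of [A]. *)
Lemma defect_1_bianchi n x a b c :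
  \sum_(i < n.+1) \tsum_(x1, x2 <- Delta x) (l i x1 a ∙ defect_1 (n - i) x2 b c)
  - defect_1 n x (a ∙ b) c + defect_1 n x a (b ∙ c)
  - \sum_(i < n.+1) \tsum_(x1, x2 <- Delta x) (defect_1 i x1 a b ∙ l (n - i)%N x2 c)
  = 0.
Proof.
have coassoc i j k :
    \tsum_(x1, x2 <- Delta x) \tsum_(y1, y2 <- Delta x2)
      (l i x1 a ∙ (l j y1 b ∙ l k y2 c))
    = \tsum_(x1, x2 <- Delta x) \tsum_(y1, y2 <- Delta x1)
      (l i y1 a ∙ l j y2 b ∙ l k x2 c).
  rewrite coassoc_trilin; last first.
    split=> [v w | u w | u v].
    - by apply: islin_amull; apply: islin_amull; apply: islin_ev; apply: linearP.
    - by apply: islin_amull; apply: islin_amulr; apply: islin_ev; apply: linearP.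
    - by apply: islin_amulr; apply: islin_ev; apply: linearP.
  by apply: eq_tsum => x1 x2; apply: eq_tsum => y1 y2; rewrite amulA.
rewrite /defect_1.
(* The first outer sum takes the form [p - q] of [alt_sum_cancel]. *)
have -> : \sum_(i < n.+1) \tsum_(x1, x2 <- Delta x)
    (l i x1 a ∙ (\sum_(j < (n - i).+1) \tsum_(y1, y2 <- Delta x2)
       (l j y1 b ∙ l (n - i - j)%N y2 c) - l (n - i)%N x2 (b ∙ c)))
  = \sum_(i < n.+1) \sum_(j < i.+1)
      \tsum_(x1, x2 <- Delta x) \tsum_(y1, y2 <- Delta x1)
        (l j y1 a ∙ l (i - j)%N y2 b ∙ l (n - i)%N x2 c)
    - \sum_(i < n.+1) \tsum_(x1, x2 <- Delta x)
        (l i x1 a ∙ l (n - i)%N x2 (b ∙ c)).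
  rewrite -(sum_antidiagA n (fun i j k =>
    \tsum_(x1, x2 <- Delta x) \tsum_(y1, y2 <- Delta x1)
      (l i y1 a ∙ l j y2 b ∙ l k x2 c))) -sumrB.
  apply: eq_bigr => i _.
  under eq_bigr => j _ do rewrite -coassoc.
  rewrite -tsum_sum -tsumB; apply: eq_tsum => x1 x2.
  rewrite amulBr amul_sumr; congr (_ - _).
  by apply: eq_bigr => j _; rewrite amul_tsumr.
(* The last outer sum takes the form [p - r], with the same [p]. *)
have -> : \sum_(i < n.+1) \tsum_(x1, x2 <- Delta x)
    ((\sum_(j < i.+1) \tsum_(y1, y2 <- Delta x1)
       (l j y1 a ∙ l (i - j)%N y2 b) - l i x1 (a ∙ b)) ∙ l (n - i)%N x2 c)
  = \sum_(i < n.+1) \sum_(j < i.+1)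
      \tsum_(x1, x2 <- Delta x) \tsum_(y1, y2 <- Delta x1)
        (l j y1 a ∙ l (i - j)%N y2 b ∙ l (n - i)%N x2 c)
    - \sum_(i < n.+1) \tsum_(x1, x2 <- Delta x)
        (l i x1 (a ∙ b) ∙ l (n - i)%N x2 c).
  rewrite -sumrB; apply: eq_bigr => i _.
  rewrite -tsum_sum -tsumB; apply: eq_tsum => x1 x2.
  rewrite amulBl amul_suml; congr (_ - _).
  by apply: eq_bigr => j _; rewrite amul_tsuml.
rewrite amulA.
exact: alt_sum_cancel.
Qed.

End Defect.

(** * The top defect, the obstruction and extensions *)

Section Extension.
Context (K : fieldType) (H : bialgType K) (A : assocAlgType K).
Variables (lam : F1 H A) (N : nat) (L : N.+1.-tuple (F1 H A)).

Lemma F2_eqP (f g : F2 H A) :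
  (forall x y a, f.1 (x ⊗ y) a = g.1 (x ⊗ y) a) /\
  (forall x a b, f.2 x (a ⊗ b) = g.2 x (a ⊗ b)) <-> f = g.
Proof.
split=> [[e0 e1] | -> //]; rewrite [f]surjective_pairing [g]surjective_pairing.
congr (_, _).
  by apply: tens_ext => x y; apply: hom_ext => a.
by apply: hom_ext => x; apply: tens_ext => a b.
Qed.

Lemma Ob_0E x y a :
  (Ob L).1 (x ⊗ y) a = \sum_(1 <= i < N.+1) L`_i x (L`_(N.+1 - i) y a).
Proof.
rewrite /Ob (big_morph fst (id1 := 0) (op1 := +%R)) // !hom_sumE.
by apply: eq_bigr => i _; rewrite tlift_pure.
Qed.

Lemma Ob_1E x a b :
  (Ob L).2 x (a ⊗ b) =
  \sum_(1 <= i < N.+1) \tsum_(x1, x2 <- Delta x) (L`_i x1 a ∙ L`_(N.+1 - i) x2 b).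
Proof.
rewrite /Ob (big_morph snd (id1 := 0) (op1 := +%R)) // !hom_sumE.
by apply: eq_bigr => i _; rewrite tlift_pure.
Qed.

Lemma nth_rcons_le (mu : F1 H A) i : (i <= N)%N -> (rcons L mu)`_i = L`_i.
Proof. by move=> iN; rewrite nth_rcons size_tuple ltnS iN. Qed.

Lemma nth_rcons_last (mu : F1 H A) : (rcons L mu)`_N.+1 = mu.
Proof. by rewrite nth_rcons size_tuple ltnn eqxx. Qed.

(** The order [M] is arbitrary because this serves both [L] and [rcons L mu]. *)
Lemma is_deformation_defect M (L' : M.+1.-tuple (F1 H A)) :
  is_deformation lam L' <->
  L'`_0 = lam /\ forall n, (n <= M)%N ->
    (forall x y a, defect_0 (nth 0 L') n x y a = 0) /\
    (forall x a b, defect_1 (nth 0 L') n x a b = 0).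
Proof.
split=> -[L0 eqs]; split=> // n /eqs [e0 e1]; split.
- by move=> x y a; rewrite /defect_0 e0 hom_sumE subrr.
- by move=> x a b; rewrite /defect_1 e1 tsum_sum subrr.
- move=> x y; apply: hom_ext => a; rewrite hom_sumE.
  by apply/esym/subr0_eq/e0.
- by move=> x a b; rewrite tsum_sum; apply/esym/subr0_eq/e1.
Qed.

Hypothesis hL : is_deformation lam L.

(** A defect of degree [n] involves only coefficients of index at most [n], and appending [mu]
    leaves these unchanged. *)
Lemma defect_0_rcons_le mu n x y a : (n <= N)%N ->
  defect_0 (nth 0 (rcons L mu)) n x y a = 0.
Proof.
move=> nN; have [_ /(_ n nN) [/(_ x y a) <- _]] := (is_deformation_defect L).1 hL.
rewrite /defect_0 nth_rcons_le //; congr (_ - _); apply: eq_bigr => i _.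
rewrite !nth_rcons_le //; first exact: leq_trans (leq_subr _ _) nN.
by rewrite (leq_trans _ nN) // -ltnS.
Qed.

Lemma defect_1_rcons_le mu n x a b : (n <= N)%N ->
  defect_1 (nth 0 (rcons L mu)) n x a b = 0.
Proof.
move=> nN; have [_ /(_ n nN) [_ /(_ x a b) <-]] := (is_deformation_defect L).1 hL.
rewrite /defect_1 nth_rcons_le //; congr (_ - _); apply: eq_bigr => i _.
rewrite !nth_rcons_le //; first exact: leq_trans (leq_subr _ _) nN.
by rewrite (leq_trans _ nN) // -ltnS.
Qed.

Lemma nth_rcons_head mu : (rcons L mu)`_0 = lam.
Proof. by rewrite nth_rcons_le //; case: hL. Qed.

(** The two end terms pair [mu] with [lam] and, together with the term in [mu (x * y)], form [d1];
    the middle terms form [Ob]. *)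
Lemma defect_0_rcons_last mu x y a :
  defect_0 (nth 0 (rcons L mu)) N.+1 x y a
  = (Ob L).1 (x ⊗ y) a + (d1 lam mu).1 (x ⊗ y) a.
Proof.
rewrite Ob_0E tlift_pure /defect_0.
rewrite (sum_ord_ends _ (fun i => (rcons L mu)`_i x ((rcons L mu)`_(N.+1 - i) y a))).
rewrite subn0 subnn nth_rcons_head nth_rcons_last.
rewrite (eq_big_nat _ _ (F2 := fun i => L`_i x (L`_(N.+1 - i) y a))); last first.
  (* The lower bound excludes index zero, so the complementary index is at most [N] too and both
     factors come from [L]. *)
  move=> [|i] // /andP [_ iN].
  by rewrite !nth_rcons_le // subSS leq_subr.
by rewrite homDE homDE homNE [X in _ = _ + X]addrAC !addrA; congr (_ + _ - _); apply: addrC.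
Qed.

Lemma defect_1_rcons_last mu x a b :
  defect_1 (nth 0 (rcons L mu)) N.+1 x a b
  = (Ob L).2 x (a ⊗ b) + (d1 lam mu).2 x (a ⊗ b).
Proof.
rewrite Ob_1E tlift_pure /defect_1.
rewrite (sum_ord_ends _ (fun i =>
  \tsum_(x1, x2 <- Delta x) ((rcons L mu)`_i x1 a ∙ (rcons L mu)`_(N.+1 - i) x2 b))).
rewrite subn0 subnn nth_rcons_head nth_rcons_last.
rewrite (eq_big_nat _ _ (F2 := fun i =>
  \tsum_(x1, x2 <- Delta x) (L`_i x1 a ∙ L`_(N.+1 - i) x2 b))); last first.
  move=> [|i] // /andP [_ iN].
  by rewrite !nth_rcons_le // subSS leq_subr.
by rewrite [X in _ = _ + X]addrAC !addrA; congr (_ + _ - _); apply: addrC.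
Qed.

Lemma is_deformation_rcons mu :
  is_deformation lam [tuple of rcons L mu] <-> - Ob L = d1 lam mu.
Proof.
rewrite is_deformation_defect -F2_eqP; split=> [[_ /(_ _ (leqnn _)) [e0 e1]] | [e0 e1]].
  split=> [x y a | x a b]; apply/esym/eqP; rewrite -addr_eq0 addrC; apply/eqP.
    by have := e0 x y a; rewrite defect_0_rcons_last.
  by have := e1 x a b; rewrite defect_1_rcons_last.
split=> [|n]; first exact: nth_rcons_head.
rewrite leq_eqVlt ltnS => /orP [/eqP-> | nN]; split.
- by move=> x y a; rewrite defect_0_rcons_last -e0 subrr.
- by move=> x a b; rewrite defect_1_rcons_last -e1 subrr.
- by move=> x y a; apply: defect_0_rcons_le.
- by move=> x a b; apply: defect_1_rcons_le.
Qed.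

Lemma d1_at0 : d1 lam 0 = 0.
Proof.
apply/F2_eqP; split=> [x y a | x a b]; rewrite tlift_pure.
  by rewrite homDE homDE homNE /= linear0 subrr addr0.
rewrite /tsum /= subr0 !big1 ?addr0 // => p _ /=; first exact: amul0l.
exact: amul0r.
Qed.

(** With [mu = 0] the term in [d1] drops out, so [Ob] is itself a defect and falls under the Bianchi
    identity. *)
Lemma Ob_defect_0 x y a :
  (Ob L).1 (x ⊗ y) a = defect_0 (nth 0 (rcons L 0)) N.+1 x y a.
Proof. by rewrite defect_0_rcons_last d1_at0 addr0. Qed.

Lemma Ob_defect_1 x a b :
  (Ob L).2 x (a ⊗ b) = defect_1 (nth 0 (rcons L 0)) N.+1 x a b.
Proof. by rewrite defect_1_rcons_last d1_at0 addr0. Qed.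

Lemma Ob_cocycle : is_cocycle2 lam (Ob L).
Proof.
rewrite /is_cocycle2 /d2; congr (_, _).
  apply: tens_ext3 => x y z; apply: hom_ext => a; rewrite tlift3_pure.
  rewrite homDE homDE homDE !homNE /= !Ob_defect_0.
  (* The zero on the right is expanded by the Bianchi identity. All terms with a defect of degree at
     most [N] vanish, so each outer sum keeps only the end term whose coefficient is [lam]. *)
  rewrite -(defect_0_bianchi (nth 0 (rcons L 0)) N.+1 x y z a).
  rewrite big_ord_recl subn0 nth_rcons_head big1 ?addr0 => [|i _]; last first.
    by rewrite defect_0_rcons_le ?linear0 // subSS leq_subr.
  rewrite big_ord_recr subnn nth_rcons_head big1 /= ?add0r // => i _.
  by rewrite defect_0_rcons_le // -ltnS.
apply: hom_ext => x; apply: tens_ext3 => a b c; rewrite tlift3_pure !Ob_defect_1.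
rewrite -[RHS]/(0 : A) -(defect_1_bianchi (nth 0 (rcons L 0)) N.+1 x a b c).
rewrite big_ord_recl subn0 nth_rcons_head big1 ?addr0 => [|i _]; last first.
  by rewrite /tsum big1 // => p _; rewrite defect_1_rcons_le ?amul0r // subSS leq_subr.
rewrite big_ord_recr subnn nth_rcons_head big1 /= ?add0r => [|i _]; last first.
  by rewrite /tsum big1 // => p _; rewrite defect_1_rcons_le ?amul0l // -ltnS.
by congr (_ - _ + _ - _); apply: eq_tsum => x1 x2; rewrite Ob_defect_1.
Qed.

End Extension.

Theorem theorem4p4 (K : fieldType) (H : bialgType K) (A : assocAlgType K)
    (lam : F1 H A) (hlam : is_module_algebra lam)
    (N : nat) (hN : (1 <= N)%N)
    (L : N.+1.-tuple (F1 H A)) (hL : is_deformation lam L) :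
  is_cocycle2 lam (Ob L) /\
  (extends lam L <-> is_coboundary2 lam (- Ob L)).
Proof.
split; first exact: Ob_cocycle.
(* One cochain serves both as the new coefficient and as the primitive of [- Ob]. *)
by split=> -[mu hmu]; exists mu; apply/is_deformation_rcons.
Qed.
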